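(* Let $q$ be a prime power. Assume that $n$ is odd and $(n-1)\mid(q^2-1)$. Put $k=\lfloor\frac{n+q-1}{q+1}\rfloor$ and $i_{\min}=\min\left(\lfloor\frac{n-q}{2}\rfloor-k,\;q-1\right)$. Assume further that $(n-1)\mid k(q+1)$. Then, for any $1\le k'\le k+i_{\min}+1$, there exists an MDS linear code $C$ with parameters $[n,k']_{q^2}$ such that $\dim(\mathrm{Hull}_H(C))=k'-\sharp\Delta_{k'}$.
   Context: An $[n,k]_{q^2}$ code is a linear code over $\mathbb{F}_{q^2}$ of length $n$ and dimension $k$; it is MDS if its minimum Hamming distance is $n-k+1$. The Hermitian inner product on $\mathbb{F}_{q^2}^n$ is $\langle x,y\rangle_H=\sum_i x_iy_i^q$, $C^{\perp_H}$ is the dual of $C$ with respect to it, and $\mathrm{Hull}_H(C)=C\cap C^{\perp_H}$. Definition of $\Delta_m$: let $\alpha_1,\dots,\alpha_{n-1}$ be the $n-1$ distinct elements of $\mathbb{F}_{q^2}$ with $\alpha_i^{n-1}=1$, let $\alpha_n=0$, put $u_i=\prod_{j\ne i}(\alpha_i-\alpha_j)^{-1}$ for $1\le i\le n$ (these lie in $\mathbb{F}_q^*$), and choose $v_i\in\mathbb{F}_{q^2}^*$ with $v_i^{q+1}=u_i$. For $j\ge0$ put $\delta_j=\sum_{l=1}^n v_l^{q+1}\alpha_l^{j(q+1)}$ (with $0^0=1$). For $m\ge1$, $\Delta_m=\{j:0\le j\le m-1,\ \delta_j\ne0\}$, and $\sharp\Delta_m$ is its cardinality. *)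

(* Defs.v *)
From HB Require Import structures.
From mathcomp Require Import all_boot all_order all_algebra.

Set Implicit Arguments.
Unset Strict Implicit.
Unset Printing Implicit Defensive.

Import Order.TTheory GRing.Theory Num.Theory.
Local Open Scope ring_scope.

Definition prime_power (q : nat) : Prop :=
  exists p e : nat, [/\ prime p, (0 < e)%N & q = (p ^ e)%N].

(* Linear codes of length n over F are subspaces C : {vspace 'rV[F]_n}; the
   parameter q of the Hermitian notions is meant to satisfy #|F| = q ^ 2. *)

Section Codes.

Variables (F : finFieldType) (n : nat).
Implicit Types (x y z : 'rV[F]_n) (C : {vspace 'rV[F]_n}).

Definition hamming_dist x y : nat := #|[set i | x 0 i != y 0 i]|.

Definition is_min_dist C (d : nat) : Prop :=
  (exists x y, [/\ x \in C, y \in C, x != y & hamming_dist x y = d])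
  /\ (forall x y, x \in C -> y \in C -> x != y -> (d <= hamming_dist x y)%N).

Definition is_MDS C (k : nat) : Prop :=
  \dim C = k /\ is_min_dist C (n - k + 1)%N.

Definition herm_prod (q : nat) x y : F := \sum_i x 0 i * y 0 i ^+ q.

(* The selected vectors already form a subspace (see mem_herm_dual), so taking
   the span only repackages them as a {vspace _}. *)
Definition herm_orth (q : nat) C : seq 'rV[F]_n :=
  [seq x <- enum {: 'rV[F]_n} | [forall y, (y \in C) ==> (herm_prod q x y == 0)]].

Definition herm_dual (q : nat) C : {vspace 'rV[F]_n} := <<herm_orth q C>>%VS.

Definition herm_hull (q : nat) C : {vspace 'rV[F]_n} :=
  (C :&: herm_dual q C)%VS.

Lemma mem_herm_dual (q : nat) C x :
  reflect (forall y, y \in C -> herm_prod q x y = 0) (x \in herm_dual q C).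
Proof.
apply: (iffP idP) => [xC y yC | xC]; last first.
  apply: memv_span; rewrite mem_filter mem_enum andbT.
  by apply/forallP => y; apply/implyP => /xC ->.
rewrite (@coord_span _ _ _ (in_tuple (herm_orth q C)) x xC) /herm_prod.
under eq_bigr do rewrite summxE mulr_suml.
rewrite exchange_big big1 //= => j _.
have := mem_nth 0 (ltn_ord j).
rewrite mem_filter => /andP[/forallP/(_ y)].
rewrite yC /= => /eqP H0 _.
under eq_bigr do rewrite mxE -mulrA.
by rewrite -mulr_sumr [X in _ * X]H0 mulr0.
Qed.

Variables (alpha v : 'I_n -> F).

Definition eval_u (i : 'I_n) : F := \prod_(j | j != i) (alpha i - alpha j)^-1.

Definition delta (q j : nat) : F :=
  \sum_(l < n) v l ^+ (q + 1) * alpha l ^+ (j * (q + 1)).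

Definition Delta (q m : nat) : {set 'I_m} := [set j : 'I_m | delta q j != 0].

End Codes.

Definition k_param (q n : nat) : nat := ((n + q - 1) %/ (q + 1))%N.

(* Integer-valued: n - q, and i_min itself, may be negative. *)
Definition i_min (q n : nat) : int :=
  Num.min (((n%:Z - q%:Z) %/ 2)%Z - (k_param q n)%:Z) (q%:Z - 1).

(* Main.v *)
Require Import Defs.
From HB Require Import structures.
From mathcomp Require Import all_boot all_order all_algebra all_field zify.

Set Implicit Arguments.
Unset Strict Implicit.
Unset Printing Implicit Defensive.

Import Order.TTheory GRing.Theory Num.Theory.
Local Open Scope ring_scope.

(* C is the generalized Reed-Solomon code with evaluation points alpha and
   multipliers v. The rows v_l alpha_l^i form a basis of C whose Hermitian Gram
   matrix has entries \sum_l u_l alpha_l^(i + j q). Such a sum vanishes unless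
   n - 1 divides i + j q: the exponent can be reduced modulo n - 1, and
   \sum_l u_l f(alpha_l) = 0 whenever deg f < n - 1. The bound on k' excludes
   this divisibility for i <> j < k', so the basis is orthogonal, with squared
   norms delta_i, and the hull is spanned by its isotropic members. *)

(* The first alternative covers the degenerate case n = q, where n - 1 properly
   divides k (q + 1). *)
Lemma i_min_bounds (q n k' : nat) : (1 < q)%N ->
  (n - 1 %| q ^ 2 - 1)%N -> (n - 1 %| k_param q n * (q + 1))%N ->
  (1 <= k')%N -> k'%:Z <= (k_param q n)%:Z + i_min q n + 1 ->
  (k' <= n)%N /\ ((k' = 1)%N \/
    (n - 1 = k_param q n * (q + 1))%N /\ (k' <= k_param q n + q)%N).
Proof.
move=> q_gt1 n_dvd k_dvd k'_ge1 k'_le.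
(* One inequality for each argument of the minimum in [i_min]. *)
have {k'_le} [k'_le1 k'_le2] :
  (q + 2 * k' <= n + 2)%N /\ (k' <= k_param q n + q)%N.
  by move: k'_le; rewrite /i_min; lia.
split; first by lia.
(* The division defining [k_param] leaves a remainder of at most [q]. *)
move: k_dvd; have [] : (k_param q n * (q + 1) <= n + q - 1)%N /\
  (n - 1 <= k_param q n * (q + 1))%N.
  by rewrite /k_param; move: (divn_eq (n + q - 1) (q + 1))
    (@ltn_pmod (n + q - 1) (q + 1) ltac:(lia)); lia.
set k := k_param q n in k'_le2 * => k_le k_ge /dvdnP[s k_def].
have [s_le1|s_ge2] := leqP s 1; first by right; split=> //; nia.
(* With [k_le] this gives [n <= q + 1], while [k'_le1] gives [n >= q]. The value [n = q + 1] is
   excluded because [q] does not divide [q ^ 2 - 1]. *)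
have : (2 * (n - 1) <= s * (n - 1))%N by rewrite leq_mul2r s_ge2 orbT.
rewrite -k_def => n_le.
left; suff : (n - 1)%N <> q by lia.
move=> n_eq; move: n_dvd.
rewrite n_eq dvdn_subr ?dvdn_exp ?expn_gt0 ?(ltnW q_gt1) // dvdn1 => /eqP q1.
by rewrite q1 in q_gt1.
Qed.

(* If k (q + 1) divides a + b q then a = b modulo q + 1; for the larger index
   u + t (q + 1), u being the smaller one, k | u + t then forces
   u + t (q + 1) >= k + q. *)
Lemma off_diagonal_ndvd (q k a b : nat) : (1 < q)%N -> (0 < k)%N ->
  (k * (q + 1) %| q ^ 2 - 1)%N -> (a < k + q)%N -> (b < k + q)%N -> a != b ->
  ~~ (k * (q + 1) %| a + b * q)%N.
Proof.
move=> q_gt1 k_gt0 kq_dvd a_lt b_lt ab; apply/negP=> ab_dvd.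
have q1_gt0 : (0 < q + 1)%N by rewrite addn1.
have k_dvd : (k %| q - 1)%N.
  by rewrite -(dvdn_pmul2r q1_gt0) -subn_sqr exp1n.
have q1_dvd : (q + 1 %| a + b * q)%N.
  by apply: dvdn_trans ab_dvd; apply: dvdn_mull.
(* For [t >= 1], [u + t * (q + 1) = (u + t) + t * q], where [u + t >= k] and [t * q >= q]. *)
have far u t : (0 < t)%N -> (k %| u + t)%N -> (k + q <= u + t * (q + 1))%N.
  move=> t_gt0 /dvdn_leq; rewrite addn_gt0 t_gt0 orbT => /(_ isT).
  by move: t_gt0; clear; nia.
have [a_lt_b|b_lt_a|eq_ab] := ltngtP a b; last by rewrite eq_ab eqxx in ab.
- have /dvdnP[t t_def] : (q + 1 %| b - a)%N.
    rewrite -(dvdn_addl _ q1_dvd).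
    have -> : (b - a + (a + b * q) = b * (q + 1))%N
      by move: a_lt_b; clear; lia.
    exact: dvdn_mull.
  have t_gt0 : (0 < t)%N.
    by case: t t_def => // /eqP; rewrite subn_eq0 leqNgt a_lt_b.
  have b_def : (b = a + t * (q + 1))%N by rewrite -t_def subnKC // ltnW.
  (* Here [a + b * q = (a + t * q) * (q + 1)], and [t * q] is congruent to [t] modulo [k] because
     [k] divides [q - 1]. *)
  have : (k %| a + t + t * (q - 1))%N.
    rewrite -(dvdn_pmul2r q1_gt0).
    suff -> : ((a + t + t * (q - 1)) * (q + 1) = a + b * q)%N by [].
    by move: q_gt1; rewrite b_def; clear; nia.
  rewrite dvdn_addl ?dvdn_mull // => /(far _ _ t_gt0).
  by rewrite leqNgt -b_def b_lt.
- have /dvdnP[t t_def] : (q + 1 %| a - b)%N.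
    rewrite -(dvdn_addl _ (dvdn_mull b (dvdnn (q + 1)))).
    by have -> : (a - b + b * (q + 1) = a + b * q)%N
      by move: b_lt_a; clear; lia.
  have t_gt0 : (0 < t)%N.
    by case: t t_def => // /eqP; rewrite subn_eq0 leqNgt b_lt_a.
  have a_def : (a = b + t * (q + 1))%N by rewrite -t_def subnKC // ltnW.
  have : (k %| b + t)%N.
    rewrite -(dvdn_pmul2r q1_gt0).
    suff -> : ((b + t) * (q + 1) = a + b * q)%N by [].
    by rewrite a_def; clear; lia.
  by move/(far _ _ t_gt0); rewrite leqNgt -a_def a_lt.
Qed.

(** * Lagrange interpolation at distinct points *)

Section EvaluationPoints.

Variables (F : finFieldType) (n : nat) (alpha : 'I_n -> F).
Hypothesis alpha_inj : injective alpha.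

Lemma card_roots_lt_size (f : {poly F}) : f != 0 ->
  (#|[set i | f.[alpha i] == 0%R]| < size f)%N.
Proof.
move=> f_neq0; set A := [set i | _].
have := @max_poly_roots _ f [seq alpha i | i <- enum A] f_neq0.
rewrite size_map -cardE; apply; last by rewrite map_inj_uniq ?enum_uniq.
by apply/allP => _ /mapP[i + ->]; rewrite mem_enum inE /root.
Qed.

Lemma poly_eval_inj (f g : {poly F}) : (size f <= n)%N -> (size g <= n)%N ->
  (forall i, f.[alpha i] = g.[alpha i]) -> f = g.
Proof.
move=> f_le g_le fg; apply/eqP; rewrite -subr_eq0; apply/contraT => fg_neq0.
have := card_roots_lt_size fg_neq0.
have -> : [set i | (f - g).[alpha i] == 0] = setT.
  by apply/setP=> i; rewrite !inE !hornerE fg subrr eqxx.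
rewrite cardsT card_ord ltnNge (leq_trans (size_polyD _ _)) //.
by rewrite geq_max f_le size_polyN.
Qed.

(** The unnormalized Lagrange basis polynomial: [eval_u alpha l] is the scalar that makes its value
    at [alpha l] equal to 1. *)
Definition lagrange_num (l : 'I_n) : {poly F} :=
  \prod_(j | j != l) ('X - (alpha j)%:P).

Lemma lagrange_num_monic l : lagrange_num l \is monic.
Proof. exact: monic_prod_XsubC. Qed.

Lemma size_lagrange_num l : size (lagrange_num l) = n.
Proof.
have -> : lagrange_num l = \prod_(j in predC1 l) ('X - (alpha j)%:P) by [].
rewrite -big_enum size_prod_XsubC -cardE cardC1 card_ord prednK //.
exact: leq_trans (ltn_ord l).
Qed.

Lemma lagrange_num_eval l i :
  (lagrange_num l).[alpha i] = if i == l then (eval_u alpha l)^-1 else 0.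
Proof.
rewrite horner_prod; case: eqP => [->|/eqP il].
  by rewrite -prodfV; apply: eq_bigr => j _; rewrite !hornerE invrK.
by rewrite (bigD1 i) //= !hornerE subrr mul0r.
Qed.

Lemma eval_u_neq0 l : eval_u alpha l != 0.
Proof.
apply/prodf_neq0 => j jl; rewrite invr_eq0 subr_eq0.
by apply: contra_neq jl => /alpha_inj.
Qed.

(* The left-hand side is the coefficient of X^(n-1) in the Lagrange
   interpolation of f at the points alpha. *)
Lemma sum_eval_u_horner (f : {poly F}) : (size f < n)%N ->
  \sum_l eval_u alpha l * f.[alpha l] = 0.
Proof.
move=> f_lt.
pose g := \sum_l (eval_u alpha l * f.[alpha l]) *: lagrange_num l.
have -> : \sum_l eval_u alpha l * f.[alpha l] = g`_n.-1.
  rewrite coef_sum; apply: eq_bigr => l _.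
  have := monicP (lagrange_num_monic l).
  by rewrite coefZ lead_coefE size_lagrange_num => ->; rewrite mulr1.
have <- : f = g; last first.
  by rewrite nth_default // -ltnS prednK // (leq_trans _ f_lt).
apply: poly_eval_inj => [||i]; first exact: ltnW.
  apply: (leq_trans (size_sum _ _ _)); apply/bigmax_leqP=> l _.
  by rewrite (leq_trans (size_scale_leq _ _)) ?size_lagrange_num.
rewrite horner_sum (bigD1 i) //= big1 => [|l li].
  by rewrite hornerZ lagrange_num_eval eqxx mulrAC mulfV ?eval_u_neq0 // mul1r addr0.
by rewrite hornerZ lagrange_num_eval eq_sym (negPf li) mulr0.
Qed.

(** * Generalized Reed-Solomon codes *)

Variable v : 'I_n -> F.
Hypothesis v_neq0 : forall i, v i != 0.

Definition grs (f : {poly F}) : 'rV[F]_n := \row_i (v i * f.[alpha i]).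

Lemma grs_is_linear : linear grs.
Proof.
by move=> c f g; apply/rowP=> i; rewrite !mxE hornerD hornerZ mulrDr mulrCA.
Qed.

HB.instance Definition _ :=
  GRing.isLinear.Build F {poly F} 'rV[F]_n _ grs grs_is_linear.

(** The monomial basis is kept explicit because the hull is computed from it; [mem_grs_code]
    recovers the description by polynomials of degree less than [k]. *)
Definition grs_basis k : k.-tuple 'rV[F]_n := [tuple grs 'X^i | i < k].
Definition grs_code k : {vspace 'rV[F]_n} := <<grs_basis k>>%VS.

Lemma nth_grs_basis k (i : 'I_k) : (grs_basis k)`_i = grs 'X^i.
Proof. by rewrite -tnth_nth tnth_mktuple. Qed.

Lemma sum_grs_basis k (c : 'I_k -> F) :
  \sum_i c i *: (grs_basis k)`_i = grs (\sum_i c i *: 'X^i).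
Proof.
rewrite linear_sum; apply: eq_bigr => i _.
by rewrite nth_grs_basis linearZ.
Qed.

Lemma size_sum_scaleXn k (c : 'I_k -> F) : (size (\sum_i c i *: 'X^i)%R <= k)%N.
Proof.
apply: (leq_trans (size_sum _ _ _)); apply/bigmax_leqP => i _.
by rewrite (leq_trans (size_scale_leq _ _)) // size_polyXn.
Qed.

Lemma mem_grs_code k x :
  reflect (exists2 f : {poly F}, (size f <= k)%N & x = grs f) (x \in grs_code k).
Proof.
apply: (iffP idP) => [/coord_span|[f f_le ->]].
  rewrite sum_grs_basis => x_def.
  by eexists; last exact: x_def; apply: size_sum_scaleXn.
rewrite -[f in grs f](@take_poly_id _ k) // /take_poly poly_def.
rewrite linear_sum rpred_sum // => i _; rewrite linearZ rpredZ //=.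
by apply: memv_span; apply/tnthP; exists i; rewrite tnth_mktuple.
Qed.

(** Since the multipliers are nonzero, a linear relation yields a polynomial of size at most
    [k <= n] that vanishes at all [n] points. *)
Lemma grs_free k : (k <= n)%N -> free (grs_basis k).
Proof.
move=> k_le; apply/freeP => c; rewrite sum_grs_basis => e i.
have : \sum_i c i *: 'X^i = 0 :> {poly F}.
  apply: poly_eval_inj => [||j]; rewrite ?size_poly0 //.
    exact: leq_trans (size_sum_scaleXn c) k_le.
  move/rowP/(_ j): e; rewrite !mxE horner0 => /eqP.
  by rewrite mulf_eq0 (negPf (v_neq0 j)) => /eqP.
move/polyP/(_ i); rewrite coef_sum (bigD1 i) //= big1 => [|j ji].
  by rewrite coefZ coefXn eqxx mulr1 addr0 coef0.
by rewrite coefZ coefXn eq_sym val_eqE (negPf ji) mulr0.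
Qed.

Lemma hamming_dist_grs f g :
  hamming_dist (grs f) (grs g) = (n - #|[set i | (f - g).[alpha i] == 0%R]|)%N.
Proof.
rewrite /hamming_dist cardsCs card_ord; congr (_ - #|pred_of_set _|)%N.
apply/setP=> i; rewrite !inE !mxE hornerD hornerN subr_eq0 negbK.
by rewrite (inj_eq (mulfI (v_neq0 i))).
Qed.

(** A nonzero polynomial of size at most [k] has at most [k - 1] roots among the points, and a
    product of [k - 1] linear factors attains this bound. *)
Lemma grs_MDS k : (0 < k)%N -> (k <= n)%N -> is_MDS (grs_code k) k.
Proof.
move=> k_gt0 k_le; split.
  by rewrite /grs_code (eqnP (grs_free k_le)) size_tuple.
have dist_eq : (n - k + 1 = n - k.-1)%N
  by rewrite -{1}(prednK k_gt0) addn1 subnSK ?prednK.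
rewrite dist_eq; split; last first.
  move=> _ _ /mem_grs_code[f f_le ->] /mem_grs_code[g g_le ->] fg.
  have fg_neq0 : f - g != 0 by rewrite subr_eq0; apply: contra_neq fg => ->.
  rewrite hamming_dist_grs leq_sub2l // -ltnS prednK //.
  apply: leq_trans (card_roots_lt_size fg_neq0) _.
  by rewrite (leq_trans (size_polyD _ _)) // geq_max f_le size_polyN.
pose A := [set i : 'I_n | (i < k.-1)%N].
have cardA : #|A| = k.-1.
  have A_le : (k.-1 <= n)%N by rewrite (leq_trans (leq_pred _)).
  rewrite -sum1_card (eq_bigl (fun i : 'I_n => (i < k.-1)%N)).
    by rewrite (big_ord_narrow A_le) sum1_card card_ord.
  by move=> i; rewrite inE.
pose f : {poly F} := \prod_(i in A) ('X - (alpha i)%:P).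
have size_f : size f = k.
  by rewrite /f -big_enum size_prod_XsubC -cardE cardA prednK.
have roots_f : [set i | f.[alpha i] == 0] = A.
  apply/setP=> i; rewrite inE horner_prod; apply/prodf_eq0/idP.
    by move=> [j jA]; rewrite !hornerE subr_eq0 => /eqP/alpha_inj ->.
  by move=> iA; exists i => //; rewrite !hornerE subrr.
have dist_f : hamming_dist (grs f) (grs 0) = (n - k.-1)%N.
  by rewrite hamming_dist_grs subr0 roots_f cardA.
exists (grs f), (grs 0); split=> //.
- by apply/mem_grs_code; exists f; rewrite ?size_f.
- by apply/mem_grs_code; exists 0; rewrite ?size_poly0.
(* The two words differ because their distance [n - k.-1] is positive. *)
apply: contra_eq_neq dist_f => ->; rewrite neq_ltn.
have -> : hamming_dist (grs 0) (grs 0) = 0%N.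
  by apply/eqP; rewrite cards_eq0; apply/eqP/setP=> i; rewrite !inE eqxx.
by rewrite subn_gt0 prednK ?k_le.
Qed.

(** * Hermitian Gram matrix of the monomial basis *)

Lemma herm_prod_grsXn q i j :
  (forall l, v l ^+ (q + 1) = eval_u alpha l) ->
  herm_prod q (grs 'X^i) (grs 'X^j) =
    \sum_l eval_u alpha l * alpha l ^+ (i + j * q).
Proof.
move=> v_norm; apply: eq_bigr => l _; rewrite !mxE !hornerXn exprMn.
by rewrite mulrACA -exprS -addn1 v_norm -exprM -exprD.
Qed.

(** This makes [Delta] the set of indices of the non-isotropic basis vectors. *)
Lemma delta_herm_prod q j :
  delta alpha v q j = herm_prod q (grs 'X^j) (grs 'X^j).
Proof.
apply: eq_bigr => l _; rewrite !mxE !hornerXn exprMn.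
by rewrite mulrACA -exprS -exprM -exprD addn1 mulnS.
Qed.

Lemma sum_eval_u_expr_root m : (0 < n - 1)%N ->
  (forall i : 'I_n, (i < n - 1)%N -> alpha i ^+ (n - 1) = 1) ->
  (forall i : 'I_n, (i = n - 1 :> nat)%N -> alpha i = 0) ->
  ~~ (n - 1 %| m)%N -> \sum_l eval_u alpha l * alpha l ^+ m = 0.
Proof.
move=> n1_gt0 alpha_root alpha_last m_ndvd.
pose r := (m %% (n - 1))%N.
(* The zero on the right becomes the sum for ['X^r], whose size [r + 1] is below [n]; the two sums
   then agree term by term. *)
rewrite -[RHS](@sum_eval_u_horner 'X^r); last first.
  by move: (ltn_pmod m n1_gt0); rewrite size_polyXn ltn_subRL add1n.
apply: eq_bigr => i _; rewrite hornerXn; congr (_ * _).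
have [i_lt|i_ge] := ltnP i (n - 1).
  by rewrite {1}(divn_eq m (n - 1)) exprD mulnC exprM alpha_root // expr1n mul1r.
rewrite alpha_last; last first.
  apply/eqP; rewrite eqn_leq i_ge andbT subn1 -ltnS.
  by rewrite (ltn_predK (ltn_ord i)).
(* At the point 0 the powers agree only if neither or both of the exponents are 0, as [0 ^+ 0 = 1].
   Here both [m] and [r] are nonzero, since [n - 1] does not divide [m]. *)
rewrite !expr0n -[r == _]/(_ %| _)%N (negPf m_ndvd).
by case: m m_ndvd {r} => //; rewrite dvdn0.
Qed.

End EvaluationPoints.

(** * Hermitian hull of a code with an orthogonal basis *)

Section OrthogonalBasis.

Variables (F : finFieldType) (n q : nat).
Hypothesis q_pchar : [pchar F].-nat q.
Implicit Types (x y : 'rV[F]_n).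

Lemma herm_prod_suml k (c : 'I_k -> F) (e : 'I_k -> 'rV[F]_n) y :
  herm_prod q (\sum_i c i *: e i) y = \sum_i c i * herm_prod q (e i) y.
Proof.
rewrite /herm_prod; under eq_bigr do rewrite summxE mulr_suml.
rewrite exchange_big; apply: eq_bigr => i _; rewrite mulr_sumr.
by apply: eq_bigr => l _; rewrite mxE mulrA.
Qed.

(** Semilinearity holds because [q_pchar] makes the [q]-th power map additive. *)
Lemma herm_prod_sumr k x (c : 'I_k -> F) (e : 'I_k -> 'rV[F]_n) :
  herm_prod q x (\sum_i c i *: e i) = \sum_i c i ^+ q * herm_prod q x (e i).
Proof.
have exprq_sum (a : 'I_k -> F) : (\sum_i a i) ^+ q = \sum_i a i ^+ q.
  apply: (big_morph (fun z => z ^+ q)) => [y z|]; first exact: exprDn_pchar.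
  by rewrite expr0n; case: q q_pchar.
rewrite /herm_prod.
under eq_bigr do rewrite summxE exprq_sum mulr_sumr.
rewrite exchange_big; apply: eq_bigr => i _; rewrite mulr_sumr.
by apply: eq_bigr => l _; rewrite mxE exprMn mulrCA.
Qed.

(** Pairing a vector of the span with [X_i] leaves only its [i]-th coordinate times the norm of
    [X_i]. Hence a hull vector has zero coordinate at every non-isotropic [X_i], and the isotropic
    ones span the hull. *)
Lemma dim_herm_hull_orthogonal k (X : k.-tuple 'rV[F]_n) : free X ->
  (forall i j : 'I_k, i != j -> herm_prod q X`_i X`_j = 0) ->
  \dim (herm_hull q <<X>>) =
    (k - #|[set i : 'I_k | herm_prod q X`_i X`_i != 0%R]|)%N.
Proof.
move=> X_free X_orth; pose A := [set i : 'I_k | herm_prod q X`_i X`_i != 0].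
pose isotropic y := herm_prod q y y == 0.
pose Y := [seq y <- X | isotropic y].
have sizeY : size Y = (k - #|A|)%N.
  have -> : (k - #|A|)%N = #|~: A| by rewrite [RHS]cardsCs setCK card_ord.
  rewrite size_filter -{1}[X : seq _]map_tnth_enum count_map.
  rewrite -sum1_count big_enum_cond -sum1_card; apply: eq_bigl => i.
  by rewrite !inE negbK /= (tnth_nth 0).
suff -> : herm_hull q <<X>> = <<Y>>%VS.
  by rewrite (eqnP (filter_free _ X_free)).
apply/vspaceP=> x; rewrite memv_cap; apply/andP/idP => [[xX]|xY].
  move/mem_herm_dual => x_orth; rewrite (coord_span xX).
  apply: rpred_sum => i _; have Xi : X`_i \in X by rewrite mem_nth ?size_tuple.
  have := x_orth _ (memv_span Xi).
  rewrite [in herm_prod _ x _](coord_span xX) herm_prod_suml.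
  rewrite (bigD1 i) //= big1 => [|j ji]; last by rewrite X_orth ?mulr0.
  rewrite addr0 => /eqP; rewrite mulf_eq0 => /orP[/eqP ->|isoXi].
    by rewrite scale0r mem0v.
  by rewrite memvZ // memv_span // mem_filter /isotropic isoXi.
have YX : {subset Y <= X} by move=> y; rewrite mem_filter => /andP[].
split; first by move: xY; apply/subvP/sub_span.
move: x xY; apply/subvP/span_subvP => y; rewrite mem_filter => /andP[y_iso yX].
(* An isotropic basis vector is orthogonal to every basis vector, itself included, hence to the
   whole span. *)
apply/mem_herm_dual => z /coord_span ->; rewrite herm_prod_sumr big1 // => j _.
have /(nthP 0)[i i_lt y_def] := yX; rewrite size_tuple in i_lt.
have [ij|ij] := eqVneq (Ordinal i_lt) j.
  by rewrite -ij /= y_def (eqP y_iso) mulr0.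
by rewrite -y_def (X_orth _ _ ij) mulr0.
Qed.

End OrthogonalBasis.

Theorem corollary4 (q n : nat) (F : finFieldType)
    (hq : prime_power q) (hF : #|F| = (q ^ 2)%N)
    (n_odd : odd n) (n_dvd : (n - 1 %| q ^ 2 - 1)%N)
    (k_dvd : (n - 1 %| k_param q n * (q + 1))%N)
    (alpha v : 'I_n -> F)
    (alpha_inj : injective alpha)
    (alpha_root : forall i : 'I_n, (i < n - 1)%N -> alpha i ^+ (n - 1) = 1)
    (alpha_last : forall i : 'I_n, (i = n - 1 :> nat)%N -> alpha i = 0)
    (v_neq0 : forall i : 'I_n, v i != 0)
    (v_norm : forall i : 'I_n, v i ^+ (q + 1) = eval_u alpha i)
    (k' : nat) (k'_ge1 : (1 <= k')%N)
    (k'_le : k'%:Z <= (k_param q n)%:Z + i_min q n + 1) :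
  exists C : {vspace 'rV[F]_n},
    is_MDS C k' /\
    \dim (herm_hull q C) = (k' - #|Delta alpha v q k'|)%N.
Proof.
have [p [e [p_prime e_gt0 q_def]]] := hq.
have q_gt1 : (1 < q)%N by rewrite q_def -(exp1n e) ltn_exp2r // prime_gt1.
have q_pchar : [pchar F].-nat q.
  have F_pchar : p \in [pchar F].
    by apply: (@card_finPcharP _ p (e * 2)); rewrite // hF q_def expnM.
  by rewrite (eq_pnat _ (pcharf_eq F_pchar)) q_def pnatX pnat_id.
have n1_gt0 : (0 < n - 1)%N.
  have q2_gt1 : (1 < q ^ 2)%N by rewrite -(exp1n 2) ltn_exp2r.
  by apply: dvdn_gt0 n_dvd; rewrite subn_gt0.
have [k'_le_n k'_cases] := i_min_bounds q_gt1 n_dvd k_dvd k'_ge1 k'_le.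
exists (grs_code alpha v k'); split; first exact: grs_MDS.
rewrite dim_herm_hull_orthogonal // => [||i j ij]; first last.
- rewrite !nth_grs_basis herm_prod_grsXn // sum_eval_u_expr_root //.
  (* For [k' = 1] there are no two distinct indices; otherwise both indices are below
     [k_param q n + q] and [off_diagonal_ndvd] applies. *)
  case: k'_cases => [k'1|[n1_def k'_small]].
    by move: ij; rewrite -val_eqE; case: i j => [[|i] +] [[|j] +] /=; rewrite k'1.
  have k_gt0 : (0 < k_param q n)%N.
    by move: n1_gt0; rewrite n1_def muln_gt0 => /andP[].
  rewrite n1_def off_diagonal_ndvd -?n1_def //.
  - exact: leq_trans k'_small.
  - exact: leq_trans k'_small.
- exact: grs_free.
congr (_ - #|pred_of_set _|)%N; apply/setP=> j.
by rewrite !inE nth_grs_basis delta_herm_prod.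
Qed.
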